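(* Let $A$ and $H$ be self-adjoint operators in a Hilbert space $\mathcal H$ such that $A$ is non-negative and $H$ is bounded and boundedly invertible. Suppose that there exists a self-adjoint involution $J_A\ne\pm I$ commuting with $A$ such that the orthogonal projectors $P_A:=\frac12(I+J_A)$ and $P_A^\bot=I-P_A$ satisfy $$P_AHP_A\ge\alpha P_A,\qquad P_A^\bot HP_A^\bot\le-\alpha P_A^\bot\qquad\text{for some }\alpha\in(0,1].$$ Let $\mathfrak b$ be the symmetric sesquilinear form given by $$\mathfrak b[x,y]:=\langle A^{1/2}x,HA^{1/2}y\rangle,\qquad \mathrm{Dom}[\mathfrak b]=\mathrm{Dom}(A^{1/2}).$$ Then there exists a unique self-adjoint operator $B$ with $\mathrm{Dom}(B)\subseteq\mathrm{Dom}[\mathfrak b]$ and $$\mathfrak b[x,y]=\langle x,By\rangle\quad\text{for all }x\in\mathrm{Dom}[\mathfrak b],\ y\in\mathrm{Dom}(B).$$ Moreover, $B$ is given by $B=A^{1/2}HA^{1/2}$ on the natural domain $$\mathrm{Dom}(B)=\{x\in\mathrm{Dom}(A^{1/2}) : HA^{1/2}x\in\mathrm{Dom}(A^{1/2})\}.$$ Furthermore, $\mathrm{Dom}(B)$ is a core for the operators $(A+I)^{1/2}$ and $A^{1/2}$.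
   Context: A self-adjoint involution is a bounded self-adjoint operator $J$ with $J^2=I$; it commutes with a self-adjoint operator $A$ if $J\,\mathrm{Dom}(A)\subseteq\mathrm{Dom}(A)$ and $JAx=AJx$ for all $x\in\mathrm{Dom}(A)$. The inequalities mean $\langle P_Ax,HP_Ax\rangle\ge\alpha\|P_Ax\|^2$ and $\langle P_A^\bot x,HP_A^\bot x\rangle\le-\alpha\|P_A^\bot x\|^2$ for all $x\in\mathcal H$. *)

(* Defs.v *)
From HB Require Import structures.
From mathcomp Require Import all_boot all_order all_algebra.
From mathcomp Require Import complex.
From mathcomp Require Import all_classical all_reals all_analysis.

Set Implicit Arguments.
Unset Strict Implicit.
Unset Printing Implicit Defensive.

Import Order.TTheory GRing.Theory Num.Theory.
Import numFieldNormedType.Exports.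

Local Open Scope classical_set_scope.
Local Open Scope ring_scope.
Local Open Scope complex_scope.

(* The forms {dot V for conjC} are linear in the first argument and           *)
(* conjugate-linear in the second one. The opposite convention amounts to     *)
(* conjugating all inner products, which changes none of the notions below.   *)
HB.mixin Record CompleteNormedModule_isHilbert (R : realType) (V : Type)
    of CompleteNormedModule R[i] V := {
  hdot : {dot V for (@Num.conj R[i])} ;
  hdotE : forall x : V, hdot x x = `|x| ^+ 2
}.

#[short(type="hilbertType")]
HB.structure Definition Hilbert (R : realType) :=
  {V of CompleteNormedModule R[i] V & CompleteNormedModule_isHilbert R V}.

(* A possibly unbounded linear operator: the values of [op] outside [dom] are *)
(* irrelevant, and equality of operators is [op_eq].                          *)
Record operator (R : realType) (V : hilbertType R) := Operator {
  dom : set V ;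
  op :> V -> V ;
  dom0 : dom 0 ;
  domP : forall (a : R[i]) x y, dom x -> dom y -> dom (a *: x + y) ;
  opP : forall (a : R[i]) x y, dom x -> dom y ->
    op (a *: x + y) = a *: op x + op y
}.

Section Operators.
Variables (R : realType) (V : hilbertType R).
Implicit Types (A B S T : operator V) (f g H J : {linear V -> V}).

Definition op_eq A B : Prop :=
  dom A = dom B /\ forall x, dom A x -> A x = B x.

Program Definition everywhere f : operator V :=
  @Operator R V setT f _ _ _.
Next Obligation. by []. Qed.
Next Obligation. by []. Qed.
Next Obligation. by move=> *; rewrite linearP. Qed.

Lemma op_lin0 A : A 0 = 0.
Proof.
have := opP 1 (dom0 A) (dom0 A).
by rewrite !scale1r addr0 => /eqP; rewrite -subr_eq0 opprD addNKr oppr_eq0 => /eqP.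
Qed.

Program Definition op_comp A B : operator V :=
  @Operator R V [set x | dom B x /\ dom A (B x)] (fun x => A (B x)) _ _ _.
Next Obligation. by move=> A B; split; rewrite ?op_lin0; exact: dom0. Qed.
Next Obligation.
move=> A B a x y [Bx ABx] [By ABy]; split; first exact: domP.
by rewrite opP//; exact: domP.
Qed.
Next Obligation. by move=> A B a x y [Bx ABx] [By ABy]; rewrite !opP. Qed.

Program Definition op_add A B : operator V :=
  @Operator R V (dom A `&` dom B) (fun x => A x + B x) _ _ _.
Next Obligation. by move=> A B; split; exact: dom0. Qed.
Next Obligation. by move=> A B a x y [? ?] [? ?]; split; exact: domP. Qed.
Next Obligation.
by move=> A B a x y [? ?] [? ?]; rewrite !opP// scalerDr addrACA.
Qed.

Definition op_id : operator V := everywhere idfun.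

Definition graph A : set (V * V) := [set p | dom A p.1 /\ A p.1 = p.2].

(* The graph of the adjoint, provided that [dom A] is dense. *)
Definition adjoint_graph A : set (V * V) :=
  [set p | forall x, dom A x -> hdot (A x) p.1 = hdot x p.2].

Definition selfadjoint A : Prop :=
  dense (dom A) /\ adjoint_graph A = graph A.

Definition nonnegative A : Prop := forall x, dom A x -> 0 <= hdot x (A x).

(* [is_sqrt A S] : S is the (unique) non-negative self-adjoint square root of *)
(* the non-negative self-adjoint operator A.                                  *)
Definition is_sqrt A S : Prop :=
  [/\ selfadjoint S, nonnegative S & op_eq (op_comp S S) A].

Definition bounded_op f : Prop :=
  exists M : R, forall x, `|f x| <= M%:C * `|x|.

Definition boundedly_invertible f : Prop :=
  exists g, [/\ bounded_op g, cancel f g & cancel g f].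

Definition selfadjoint_involution J : Prop :=
  [/\ bounded_op J, selfadjoint (everywhere J) & involutive J].

Definition commutes_with J A : Prop :=
  forall x, dom A x -> dom A (J x) /\ J (A x) = A (J x).

Definition proj_of J (x : V) : V := 2^-1 *: (x + J x).
Definition coproj_of J (x : V) : V := x - proj_of J x.

(* The domain of [sform S H] is [dom S]. *)
Definition sform S H (x y : V) : R[i] := hdot (S x) (H (S y)).

Definition represents (D : set V) (b : V -> V -> R[i]) B : Prop :=
  dom B `<=` D /\ forall x y, D x -> dom B y -> b x y = hdot x (B y).

(* D is a core for T when the closure of the restriction of T to D is T. *)
Definition core (D : set V) T : Prop :=
  D `<=` dom T /\ closure [set p : V * V | D p.1 /\ T p.1 = p.2] = graph T.

End Operators.

(* Main.v *)
Require Import Defs.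
From HB Require Import structures.
From mathcomp Require Import all_boot all_order all_algebra.
From mathcomp Require Import complex.
From mathcomp Require Import all_classical all_reals all_analysis.
From mathcomp Require Import ring lra.

Set Implicit Arguments.
Unset Strict Implicit.
Unset Printing Implicit Defensive.

Import Order.TTheory GRing.Theory Num.Theory.
Import numFieldNormedType.Exports.

Local Open Scope classical_set_scope.
Local Open Scope ring_scope.
Local Open Scope complex_scope.

(** Write S = A^(1/2), and let B be S H S on its natural domain. Everything
    rests on one coercivity estimate. As J is an isometry, the parts p = P u and
    q = u - P u are orthogonal, and in Re <J u, H u> = Re <p - q, H (p + q)> the
    mixed terms cancel, so the hypotheses on the diagonal blocks of H give
    Re <J u, H u> >= alpha |u|^2 ([coercive_of_blocks]). The involution J also
    commutes with S, because J S J is another non-negative square root of A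
    ([commute_sqrt]). Hence the form c[x, y] = <S x, J H S y> + <x, y> is
    bounded and coercive on Dom(S) with its graph norm, and by the Lax-Milgram lemma
    each z has a y in Dom(S) with c[x, y] = <x, z> for all x in Dom(S). Since S
    is self-adjoint, this says that J H S y lies in Dom(S) and that
    S J H S y + y = z; moving J through S gives y in Dom(B) and (B + J) y = J z.
    Therefore B + J is onto ([form_op_J_surj]). A densely defined symmetric
    operator that is onto after a bounded symmetric perturbation is self-adjoint
    ([form_op_selfadjoint]).

    The resolvent (S + i)^-1 is an isometry of the space onto Dom(S) with the
    graph norm, because |(S + i) x|^2 = |S x|^2 + |x|^2. It turns c into an
    everywhere defined bounded coercive operator C, so that no second Hilbert
    space is needed. In this picture Dom(B) corresponds to C^-1 (Dom(S)), which
    is dense because Dom(S) is dense and C is an isomorphism: this is the core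
    property for S ([form_op_graph_dense]).

    If B' is self-adjoint and represents the form, the self-adjointness of S puts
    H S y in Dom(S) for each y in Dom(B'), so B extends B' and both are equal.
    Finally a square root T of A + I satisfies |T x|^2 = |S x|^2 + |x|^2 on
    Dom(A), which is a core of S and of T; so S and T have the same domain and
    equivalent graph norms, hence the same cores.

    All estimates are made in the ordered field R, with the real part of the
    inner product; multiplication by i recovers the complex inner product. *)

(** * The real part of the inner product *)

Section RealDot.
Variables (R : realType) (V : hilbertType R).
Implicit Types (x y z : V) (r : R).

Definition rdot x y : R := complex.Re (hdot x y).
Definition sqn x : R := rdot x x.

Lemma hdotC x y : hdot x y = conjc (hdot y x).
Proof. by rewrite (hermC (@hdot R V)) expr0 mul1r. Qed.

Lemma rdotC x y : rdot x y = rdot y x.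
Proof. by rewrite /rdot hdotC; case: (hdot y x). Qed.

Lemma rdotDl x y z : rdot (x + y) z = rdot x z + rdot y z.
Proof.
rewrite /rdot; have -> : hdot (x + y) z = hdot x z + hdot y z :> R[i].
  by rewrite linearDl.
by case: (hdot x z) => ? ?; case: (hdot y z).
Qed.

Lemma rdotNl x y : rdot (- x) y = - rdot x y.
Proof. by rewrite /rdot linearNl /=; case: (hdot x y) => a b. Qed.

Lemma rdotBl x y z : rdot (x - y) z = rdot x z - rdot y z.
Proof. by rewrite rdotDl rdotNl. Qed.

Lemma rdotDr x y z : rdot z (x + y) = rdot z x + rdot z y.
Proof. by rewrite rdotC rdotDl !(rdotC z). Qed.

Lemma rdotNr x y : rdot y (- x) = - rdot y x.
Proof. by rewrite rdotC rdotNl (rdotC y). Qed.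

Lemma rdotBr x y z : rdot z (x - y) = rdot z x - rdot z y.
Proof. by rewrite rdotDr rdotNr. Qed.

Lemma rdot0l x : rdot 0 x = 0.
Proof. by rewrite -(subrr x) rdotBl subrr. Qed.

Lemma rdot0r x : rdot x 0 = 0.
Proof. by rewrite rdotC rdot0l. Qed.

Lemma hdotZl (a : R[i]) x y : hdot (a *: x) y = a * hdot x y.
Proof. by rewrite linearZl_LR. Qed.

Lemma hdotZr (a : R[i]) x y : hdot x (a *: y) = conjc a * hdot x y.
Proof. by rewrite linearZr_LR. Qed.

Lemma rdotZl r x y : rdot (r%:C *: x) y = r * rdot x y.
Proof. by rewrite /rdot hdotZl; case: (hdot x y) => a b /=; ring. Qed.

Lemma rdotZr r x y : rdot y (r%:C *: x) = r * rdot y x.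
Proof. by rewrite rdotC rdotZl rdotC. Qed.

Lemma scale_ii x : 'i *: ('i *: x) = - x.
Proof. by rewrite scalerA -expr2 sqr_i scaleN1r. Qed.

Lemma rdot_il x y : rdot ('i *: x) y = - rdot x ('i *: y).
Proof.
rewrite /rdot hdotZl hdotZr.
by case: (hdot x y) => a b /=; ring.
Qed.

Lemma rdot_ir x y : rdot x ('i *: y) = - rdot ('i *: x) y.
Proof. by rewrite rdot_il opprK. Qed.

(** Identities between inner products can thus be proved on real parts
    alone, as soon as they are also known after multiplying by i. *)
Lemma hdotRe x y : hdot x y = rdot x y +i* rdot x ('i *: y).
Proof.
by rewrite /rdot hdotZr; case: (hdot x y) => a b /=; congr (_ +i* _); ring.
Qed.

Lemma sqn_norm x : `|x| ^+ 2 = (sqn x)%:C.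
Proof.
rewrite -hdotE hdotRe; congr (_ +i* _).
by have := rdot_il x x; rewrite rdotC => H; lra.
Qed.

Lemma sqn_ge0 x : 0 <= sqn x.
Proof. by rewrite -lecR -sqn_norm exprn_ge0. Qed.

Lemma norm_sqrt x : `|x| = (Num.sqrt (sqn x))%:C.
Proof.
apply/eqP; rewrite -(@eqrXn2 _ 2)// ?ler0c ?sqrtr_ge0// sqn_norm.
by rewrite -rmorphXn/= sqr_sqrtr// sqn_ge0.
Qed.

Lemma sqn_eq0 x : sqn x = 0 -> x = 0.
Proof. by move=> x0; apply/normr0_eq0; rewrite norm_sqrt x0 sqrtr0. Qed.

Lemma sqn0 : sqn 0 = 0. Proof. exact: rdot0l. Qed.
Lemma sqnN x : sqn (- x) = sqn x.
Proof. by rewrite /sqn rdotNl rdotNr opprK. Qed.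
Lemma sqn_i x : sqn ('i *: x) = sqn x.
Proof. by rewrite /sqn rdot_il scale_ii rdotNr opprK. Qed.
Lemma sqnZ r x : sqn (r%:C *: x) = r ^+ 2 * sqn x.
Proof. by rewrite /sqn rdotZl rdotZr mulrA. Qed.
Lemma sqnD x y : sqn (x + y) = sqn x + 2 * rdot x y + sqn y.
Proof. by rewrite /sqn rdotDl !rdotDr (rdotC y x); ring. Qed.
Lemma sqnB x y : sqn (x - y) = sqn x - 2 * rdot x y + sqn y.
Proof. by rewrite sqnD sqnN rdotNr; ring. Qed.
Lemma sqnBC x y : sqn (x - y) = sqn (y - x).
Proof. by rewrite -opprB sqnN. Qed.

Lemma sqnD_le x y : sqn (x + y) <= 2 * sqn x + 2 * sqn y.
Proof. by have := sqn_ge0 (x - y); rewrite sqnB sqnD => h; lra. Qed.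

Lemma sqnB_le x y : sqn (x - y) <= 2 * sqn x + 2 * sqn y.
Proof. by rewrite -(sqnN y) sqnD_le. Qed.

Lemma sqn_tri z x y : sqn (x - y) <= 2 * sqn (x - z) + 2 * sqn (z - y).
Proof. by rewrite -(subrKA z x) sqnD_le. Qed.

(** The parallelogram identity at z - x and z - y; it makes minimizing
    sequences of the distance from z to a subspace Cauchy. *)
Lemma sqn_median z x y :
  sqn (x - y) =
    2 * sqn (z - x) + 2 * sqn (z - y) - 4 * sqn (z - 2^-1%:C *: (x + y)).
Proof. by rewrite !sqnB sqnZ sqnD rdotZr rdotDr; field. Qed.

Lemma cauchy_schwarz x y : rdot x y ^+ 2 <= sqn x * sqn y.
Proof.
have [y0|y_neq0] := eqVneq (sqn y) 0.
  by rewrite (sqn_eq0 y0) rdot0r sqn0 mulr0 expr0n.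
have y_gt0 : 0 < sqn y by rewrite lt_neqAle eq_sym y_neq0 sqn_ge0.
have := sqn_ge0 ((sqn y)%:C *: x - (rdot x y)%:C *: y).
rewrite sqnB !sqnZ rdotZl rdotZr => h.
rewrite -subr_ge0 -(pmulr_rge0 _ y_gt0).
by apply: le_trans h _; rewrite le_eqVlt; apply/orP; left; apply/eqP; ring.
Qed.

Lemma rdot_le x y : 2 * rdot x y <= sqn x + sqn y.
Proof. by have := sqn_ge0 (x - y); rewrite sqnB; lra. Qed.

Lemma eq0_small r C : (forall e, 0 < e -> r ^+ 2 <= C * e) -> r = 0.
Proof.
move=> h; apply/eqP; rewrite -sqrf_eq0 eq_le sqr_ge0 andbT.
apply/ler_addgt0Pr => e e0; rewrite add0r.
have C1 : 0 < `|C| + 1 by have := normr_ge0 C; lra.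
have := h (e / (`|C| + 1)) (divr_gt0 e0 C1) => /le_trans; apply.
rewrite mulrCA ler_piMr//; first exact: ltW.
rewrite ler_pdivrMr//.
by have := ler_norm C; lra.
Qed.

Lemma sqn_small x : (forall e, 0 < e -> sqn x <= e) -> x = 0.
Proof.
move=> h; apply: sqn_eq0; apply/eqP; rewrite eq_le sqn_ge0 andbT.
by apply/ler_addgt0Pr => e e0; rewrite add0r; exact: h.
Qed.

End RealDot.

(** * The topology in terms of squared norms *)

Section Topology.
Variables (R : realType) (V : hilbertType R).
Implicit Types (x y z : V) (r : R).

Lemma gt0c_real (e : R[i]) : 0 < e -> exists2 r : R, 0 < r & e = r%:C.
Proof.
case: e => a b; rewrite ltcE /= => /andP[/eqP -> a0].
by exists a.
Qed.

Lemma norm_lt_sqn x r : 0 < r -> (`|x| < r%:C) = (sqn x < r ^+ 2).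
Proof.
move=> r0; rewrite norm_sqrt ltcR -{1}(ger0_norm (ltW r0)) -sqrtr_sqr.
by rewrite ltr_sqrt// exprn_gt0.
Qed.

Lemma nbhs_sqnP x (B : set V) :
  nbhs x B <-> exists2 e : R, 0 < e & forall y, sqn (x - y) < e -> B y.
Proof.
split=> [/nbhs_ballP[e /= /gt0c_real[r r0 ->] xB]|[e e0 eB]].
  exists (r ^+ 2); first exact: exprn_gt0.
  by move=> y xy; apply: xB; rewrite -ball_normE /= norm_lt_sqn.
apply/nbhs_ballP; exists (Num.sqrt e)%:C => /=; first by rewrite ltcR sqrtr_gt0.
move=> y; rewrite -ball_normE /= norm_lt_sqn ?sqrtr_gt0// sqr_sqrtr ?ltW//.
exact: eB.
Qed.

Definition approximable (D : set V) x :=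
  forall e : R, 0 < e -> exists2 y, D y & sqn (x - y) < e.

Lemma denseP (D : set V) : dense D <-> forall x, approximable D x.
Proof.
split=> [dD x e e0|dD O [x Ox] oO].
  have [] := dD (ball x (Num.sqrt e)%:C).
  - by exists x; apply: ballxx; rewrite ltcR sqrtr_gt0.
  - exact: ball_open.
  move=> y [/=]; rewrite -ball_normE /= norm_lt_sqn ?sqrtr_gt0// sqr_sqrtr ?ltW//.
  by exists y.
have /nbhs_sqnP[e e0 eO] : nbhs x O by apply: open_nbhs_nbhs.
by have [y Dy xy] := dD x e e0; exists y; split=> //; exact: eO.
Qed.

Lemma closure_pairP (G : set (V * V)) (p : V * V) :
  closure G p <-> forall e : R, 0 < e ->
    exists q, [/\ G q, sqn (p.1 - q.1) < e & sqn (p.2 - q.2) < e].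
Proof.
split=> [cG e e0|h B].
  have [|q [Gq []]] := cG [set q | sqn (p.1 - q.1) < e /\ sqn (p.2 - q.2) < e].
    exists ([set q | sqn (p.1 - q) < e], [set q | sqn (p.2 - q) < e]) => /=.
      by split; apply/nbhs_sqnP; exists e.
    by move=> [a b] [].
  by exists q.
move=> [[B1 B2] /= [/nbhs_sqnP[e1 e10 h1] /nbhs_sqnP[e2 e20 h2]] sB].
have [|q [Gq q1 q2]] := h (Num.min e1 e2); first by rewrite lt_min e10.
exists q; split=> //; apply: sB; split=> /=.
  by apply: h1; apply: lt_le_trans q1 _; rewrite ge_min lexx.
by apply: h2; apply: lt_le_trans q2 _; rewrite ge_min lexx orbT.
Qed.

(** Completeness without sequences: F e collects the approximations of an
    unknown limit up to precision e. *)
Lemma complete_family (F : R -> V -> Prop) :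
  (forall e : R, 0 < e -> exists x, F e x) ->
  (forall (d e : R) x y, 0 < d -> 0 < e -> F d x -> F e y -> sqn (x - y) <= d + e) ->
  exists l, forall (e : R) x, 0 < e -> F e x -> sqn (x - l) <= 2 * e.
Proof.
move=> F0 FC.
have inv_gt0 n : 0 < (n.+1%:R : R)^-1 by rewrite invr_gt0 ltr0n.
have [u uF] : {u : nat -> V & forall n, F n.+1%:R^-1 (u n)}.
  by apply: (@choice _ _ (fun n x => F n.+1%:R^-1 x)) => n; exact: F0.
have small (e : R) : 0 < e -> \forall n \near \oo, (n.+1%:R : R)^-1 < e.
  move=> e0; exact: near_infty_natSinv_lt (PosNum e0).
have u_cauchy : cauchy (u @ \oo).
  apply/cauchy_exP => e /gt0c_real[r r0 ->].
  have r2 : 0 < r ^+ 2 / 2 by rewrite divr_gt0// exprn_gt0.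
  have [N _ HN] := small _ r2.
  exists (u N); exists N => // n /= Nn; rewrite -ball_normE /= norm_lt_sqn//.
  apply: le_lt_trans (FC _ _ _ _ (inv_gt0 N) (inv_gt0 n) (uF N) (uF n)) _.
  have := HN N (leqnn N); have := HN n Nn => /=.
  set a := N.+1%:R^-1; set b := n.+1%:R^-1 => ? ?; lra.
have /cvgrPdist_lt ul : u @ \oo --> lim (u @ \oo) by exact: cauchy_cvg.
exists (lim (u @ \oo)) => e x e0 Fx.
apply/ler_addgt0Pr => d d0.
have d4 : 0 < d / 4 by lra.
have [N1 _ HN1] := small _ d4.
have [|N2 _ HN2] := ul (Num.sqrt (d / 4))%:C; first by rewrite ltcR sqrtr_gt0.
pose n := maxn N1 N2.
have /= h1 := HN1 n (leq_maxl _ _); have /= := HN2 n (leq_maxr _ _).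
rewrite norm_lt_sqn ?sqrtr_gt0// sqr_sqrtr; last exact: ltW.
move=> h2; rewrite sqnBC in h2.
have := FC _ _ _ _ e0 (inv_gt0 n) Fx (uF n).
have := sqn_tri (u n) x (lim (u @ \oo)).
move: h1 h2; set a := n.+1%:R^-1 => ? ? ? ?. lra.
Qed.

End Topology.
(** * Subspaces with trivial orthogonal complement *)

Section Density.
Variables (R : realType) (V : hilbertType R).
Implicit Types (x y z u v w : V) (r e : R) (D M : set V).

(** The projection theorem: near-minimizers m of |v - m| over M form a
    Cauchy family, and at their limit l the vector v - l is orthogonal to M,
    hence zero. *)
Lemma orth_dense M : M 0 ->
  (forall (a : R[i]) x y, M x -> M y -> M (a *: x + y)) ->
  (forall w, (forall m, M m -> rdot w m = 0) -> w = 0) ->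
  forall v, approximable M v.
Proof.
move=> M0 Mlin Morth v.
have MZ (a : R[i]) x : M x -> M (a *: x).
  by move=> Mx; rewrite -[_ *: _]addr0; exact: Mlin.
have MD x y : M x -> M y -> M (x + y).
  by move=> Mx My; rewrite -(scale1r x); exact: Mlin.
pose E : set R := [set r | exists2 m, M m & r = sqn (v - m)].
pose d := inf E.
have lbE : has_lbound E by exists 0 => _ [m _ ->]; exact: sqn_ge0.
have infE : has_inf E by split=> //; exists (sqn (v - 0)); exists 0.
have d_le m : M m -> d <= sqn (v - m) by move=> Mm; apply: ge_inf => //; exists m.
pose F e x := M x /\ sqn (v - x) <= d + e / 2.
have Fex e : 0 < e -> exists x, F e x.
  move=> e0; have e2 : 0 < e / 2 by lra.
  have [_ [m Mm ->] /ltW hm] := inf_adherent e2 infE.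
  by exists m.
have [|l lP] := complete_family Fex.
  move=> a b x y a0 b0 [Mx hx] [My hy].
  have := d_le _ (MZ (2^-1)%:C _ (MD _ _ Mx My)).
  by rewrite (sqn_median v x y); lra.
have w0 : v - l = 0.
  apply: Morth => m Mm; apply: (@eq0_small _ _ (5 * sqn m)) => e e0.
  have [x Fx] := Fex e e0; have xl := lP e x e0 Fx; case: Fx => Mx hx.
  (* First order condition: compare x with its optimal translate along m. *)
  have h1 : rdot (v - x) m ^+ 2 <= sqn m * (e / 2).
    have [m0|m_neq0] := eqVneq (sqn m) 0.
      by rewrite (sqn_eq0 m0) rdot0r sqn0 mul0r expr0n.
    have m_gt0 : 0 < sqn m by rewrite lt_neqAle eq_sym m_neq0 sqn_ge0.
    have := d_le _ (MD _ _ Mx (MZ (rdot (v - x) m / sqn m)%:C _ Mm)).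
    rewrite opprD addrA sqnB sqnZ rdotZr => h.
    rewrite -subr_ge0 -(pmulr_rge0 _ (x := (sqn m)^-1)) ?invr_gt0//.
    suff -> : (sqn m)^-1 * (sqn m * (e / 2) - rdot (v - x) m ^+ 2) =
      e / 2 - 2 * (rdot (v - x) m / sqn m * rdot (v - x) m) +
        (rdot (v - x) m / sqn m) ^+ 2 * sqn m by lra.
    by field.
  rewrite -(subrKA x v) rdotDl.
  have := cauchy_schwarz (x - l) m; have := ler_wpM2r (sqn_ge0 m) xl.
  have := sqr_ge0 (rdot (v - x) m - rdot (x - l) m).
  move: h1; rewrite !expr2.
  set a := rdot _ m; set b := rdot _ m; set s := sqn m => ? ? ? ?.
  nra.
move=> e e0; have [|x Fx] := Fex (e / 4); first by lra.
have e4 : 0 < e / 4 by lra.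
exists x; first by case: Fx.
rewrite sqnBC (subr0_eq w0).
by have := lP _ x e4 Fx; lra.
Qed.

Lemma dense_eq0 D w : (forall x, approximable D x) ->
  (forall x, D x -> rdot x w = 0) -> w = 0.
Proof.
move=> dD Dw; apply: sqn_eq0; apply: (@eq0_small _ _ (sqn w)) => e e0.
have [y Dy wy] := dD w e e0.
have eq_w : sqn w = rdot (w - y) w by rewrite rdotBl (Dw y)// subr0.
rewrite {1}eq_w.
apply: le_trans (cauchy_schwarz _ _) _.
by rewrite mulrC ler_wpM2l ?sqn_ge0// ltW.
Qed.

Lemma approximable_le D M x : D `<=` M -> approximable D x -> approximable M x.
Proof. by move=> DM Dx e e0; have [y /DM My ?] := Dx e e0; exists y. Qed.

End Density.

(** * Self-adjoint and closed operators *)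

Section OperatorTheory.
Variables (R : realType) (V : hilbertType R).
Implicit Types (x y z u v w f : V) (r e s : R) (D M : set V) (S T : operator V).

Lemma domZ S (a : R[i]) x : dom S x -> dom S (a *: x).
Proof. by move=> Sx; rewrite -[_ *: _]addr0; apply: domP => //; exact: dom0. Qed.

Lemma domD S x y : dom S x -> dom S y -> dom S (x + y).
Proof. by move=> Sx Sy; rewrite -(scale1r x); exact: domP. Qed.

Lemma domB S x y : dom S x -> dom S y -> dom S (x - y).
Proof. by move=> Sx Sy; rewrite -scaleN1r; apply: domD => //; exact: domZ. Qed.

Lemma opZ S (a : R[i]) x : dom S x -> S (a *: x) = a *: S x.
Proof.
by move=> Sx; rewrite -[a *: x]addr0 opP ?op_lin0 ?addr0//; exact: dom0.
Qed.

Lemma opD S x y : dom S x -> dom S y -> S (x + y) = S x + S y.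
Proof. by move=> Sx Sy; rewrite -{1}(scale1r x) opP// scale1r. Qed.

Lemma opB S x y : dom S x -> dom S y -> S (x - y) = S x - S y.
Proof.
move=> Sx Sy; rewrite -scaleN1r opD//; last exact: domZ.
by rewrite opZ// scaleN1r.
Qed.

Lemma sa_sym S x y : selfadjoint S -> dom S x -> dom S y ->
  rdot (S x) y = rdot x (S y).
Proof.
move=> [_ adjS] Sx Sy; rewrite /rdot; congr complex.Re.
have : graph S (y, S y) by [].
by rewrite -adjS; apply.
Qed.

(** The real part of the defining identity of the adjoint suffices, because
    it can be used at i x. *)
Lemma sa_mem S u v : selfadjoint S ->
  (forall x, dom S x -> rdot (S x) u = rdot x v) -> dom S u /\ S u = v.
Proof.
move=> [_ adjS] uv; suff : graph S (u, v) by [].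
rewrite -adjS => x Sx /=; rewrite !hdotRe uv// !rdot_ir -opZ// uv//.
exact: domZ.
Qed.

Lemma sa_dense S : selfadjoint S -> forall x, approximable (dom S) x.
Proof. by move=> [/denseP]. Qed.

Lemma sa_intro S : (forall x, approximable (dom S) x) ->
  (forall x y, dom S x -> dom S y -> rdot (S x) y = rdot x (S y)) ->
  (forall u v, (forall x, dom S x -> rdot (S x) u = rdot x v) -> dom S u) ->
  selfadjoint S.
Proof.
move=> dS symS memS; split; first exact/denseP.
apply/seteqP; split=> [[u v]|[u v] [/= Su <-]] /=.
  move=> /= uv.
  have uv' x : dom S x -> rdot (S x) u = rdot x v.
    by move=> Sx; rewrite /rdot uv.
  have Su := memS _ _ uv'; split=> //=.
  apply/eqP; rewrite -subr_eq0; apply/eqP/(dense_eq0 dS) => x Sx.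
  by rewrite rdotBr -symS// uv'// subrr.
move=> x Sx /=; rewrite !hdotRe symS// !rdot_ir -opZ// symS//.
exact: domZ.
Qed.

Definition closed_op D (T : V -> V) :=
  forall u v, (forall e, 0 < e ->
    exists x, [/\ D x, sqn (u - x) <= e & sqn (v - T x) <= e]) ->
  D u /\ T u = v.

(** The identity <S y, u> = <y, S u> passes to limits in u for each fixed y,
    and characterizes the graph of S. *)
Lemma sa_closed S : selfadjoint S -> closed_op (dom S) S.
Proof.
move=> saS u v uv; apply: sa_mem => // y Sy.
apply/eqP; rewrite -subr_eq0; apply/eqP.
apply: (@eq0_small _ _ (2 * sqn (S y) + 2 * sqn y)) => e e0.
have [x [Sx ux vx]] := uv e e0.
have -> : rdot (S y) u - rdot y v = rdot (S y) (u - x) - rdot y (v - S x).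
  by rewrite !rdotBr (sa_sym saS Sy Sx); ring.
have := cauchy_schwarz (S y) (u - x); have := cauchy_schwarz y (v - S x).
have := ler_wpM2l (sqn_ge0 (S y)) ux; have := ler_wpM2l (sqn_ge0 y) vx.
have := sqr_ge0 (rdot (S y) (u - x) + rdot y (v - S x)).
rewrite !expr2; nra.
Qed.

(** The range is dense by [orth_dense]; the lower bound turns convergence of
    images into convergence of preimages, so the range is also closed. *)
Lemma closed_surj T c : closed_op (dom T) T -> 0 < c ->
  (forall x, dom T x -> c * sqn x <= sqn (T x)) ->
  (forall w, (forall x, dom T x -> rdot w (T x) = 0) -> w = 0) ->
  forall v, exists2 x, dom T x & T x = v.
Proof.
move=> clT c0 Tc Torth v.
have ranT : approximable [set y | exists2 x, dom T x & y = T x] v.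
  apply: orth_dense.
  - by exists 0; [exact: dom0|rewrite op_lin0].
  - move=> a _ _ [x Tx ->] [y Ty ->]; exists (a *: x + y); first exact: domP.
    by rewrite opP.
  - by move=> w h; apply: Torth => x Tx; apply: h; exists x.
pose F e x := dom T x /\ sqn (v - T x) <= c * e / 2.
have Fex e : 0 < e -> exists x, F e x.
  move=> e0; have [|_ [x Tx ->] /ltW h] := ranT (c * e / 2).
    by rewrite divr_gt0// mulr_gt0.
  by exists x.
have [|l lP] := complete_family Fex.
  move=> a b x y a0 b0 [Tx hx] [Ty hy].
  rewrite -(ler_pM2l c0) mulrDr.
  apply: le_trans (Tc _ (domB Tx Ty)) _; rewrite opB//.
  have := sqn_tri v (T x) (T y); rewrite (sqnBC (T x) v); lra.
have [Tl <-] : dom T l /\ T l = v; last by exists l.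
apply: clT => e e0.
have m0 : 0 < Num.min (e / 2) (e / c) by rewrite lt_min !divr_gt0.
have [x Fx] := Fex _ m0; have := lP _ _ m0 Fx; case: Fx => Tx hx hl.
exists x; split=> //.
  rewrite sqnBC (le_trans hl)//.
  have : Num.min (e / 2) (e / c) <= e / 2 by rewrite ge_min lexx.
  by set m := Num.min _ _ => ?; lra.
have h : c * Num.min (e / 2) (e / c) <= e.
  by rewrite -ler_pdivlMl// ge_min (mulrC c^-1) lexx orbT.
by apply: le_trans hx _; move: h; set m := c * _ => ?; lra.
Qed.

End OperatorTheory.

(** * Resolvents and density for the graph norm *)

Section Resolvent.
Variables (R : realType) (V : hilbertType R).
Implicit Types (x y z u v w f g k : V) (r e s : R) (D M : set V).
Implicit Types A S T : operator V.

(** The operator S + s i, meant for s = 1 and s = -1. *)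
Program Definition ishift S s : operator V :=
  @Operator R V (dom S) (fun x => S x + s%:C *: ('i *: x)) _ _ _.
Next Obligation. by move=> S s; exact: dom0. Qed.
Next Obligation. by move=> S s a x y; exact: domP. Qed.
Next Obligation.
move=> S s a x y Sx Sy /=; rewrite opP// !scalerDr addrACA; congr (_ + _ + _).
by rewrite !scalerA; congr (_ *: _); ring.
Qed.

Lemma rdot_S_i S x : selfadjoint S -> dom S x -> rdot (S x) ('i *: x) = 0.
Proof.
move=> saS Sx; have := sa_sym saS Sx (domZ 'i Sx).
rewrite opZ// (rdot_ir x) (rdotC _ (S x)) => h; lra.
Qed.

Lemma ishift_sqn S s x : selfadjoint S -> s ^+ 2 = 1 -> dom S x ->
  sqn (ishift S s x) = sqn (S x) + sqn x.
Proof.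
move=> saS s1 Sx; rewrite /= sqnD sqnZ s1 sqn_i rdotZr rdot_S_i//; ring.
Qed.

Lemma ishift_closed S s : selfadjoint S -> closed_op (dom S) (ishift S s).
Proof.
move=> saS u v uv.
suff [Su Suv] : dom S u /\ S u = v - s%:C *: ('i *: u).
  by split=> //=; rewrite Suv subrK.
apply: (sa_closed saS) => e e0.
pose c := 2 + 2 * s ^+ 2.
have c2 : 2 <= c by rewrite lerDl mulr_ge0 ?sqr_ge0.
have [|x [Sx ux vx]] := uv (e / c); first by rewrite divr_gt0//; lra.
have ec : e / c * c = e by rewrite divfK// lt0r_neq0//; lra.
exists x; split=> //.
  by apply: le_trans ux _; rewrite ler_pdivrMr; [nra|lra].
have -> : v - s%:C *: ('i *: u) - S x =
    (v - (S x + s%:C *: ('i *: x))) - s%:C *: ('i *: (u - x)).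
  by rewrite !scalerBr opprB addrA (opprD (S x)) !addrA subrK addrAC.
apply: le_trans (sqnB_le _ _) _; rewrite sqnZ sqn_i.
have := sqr_ge0 s; move: vx ux ec; rewrite /= /c.
set a := sqn _; set b := sqn _; set d := e / _ => ? ? <- ?; nra.
Qed.

(** A vector w orthogonal to the range of S + s i is in Dom(S) and satisfies
    S w = s i w; as S is symmetric, this forces w = 0. *)
Lemma ishift_surj S s : selfadjoint S -> s ^+ 2 = 1 ->
  forall f, exists2 x, dom S x & S x + s%:C *: ('i *: x) = f.
Proof.
move=> saS s1; apply: (@closed_surj _ _ (ishift S s) 1) => //.
- exact: (ishift_closed saS).
- by move=> x Sx; rewrite ishift_sqn// mul1r lerDr sqn_ge0.
move=> w wS.
have [Sw Sw_eq] : dom S w /\ S w = s%:C *: ('i *: w).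
  apply: sa_mem => // x Sx; have := wS x Sx.
  by rewrite /= rdotDr !rdotZr !(rdotC w) rdot_il => h; lra.
apply: sqn_eq0; have := wS _ (domZ 'i Sw).
rewrite /= opZ// Sw_eq scale_ii rdotDr rdotZr rdotNr scalerA mulrC -scalerA.
by rewrite scale_ii rdotZr rdotNr /sqn => h; have : s != 0; [nra|nra].
Qed.

(** The inverse of S + s i for s = 1 and s = -1, where the default value 0 is
    never taken; it is an isometry onto Dom(S) with the graph norm
    ([iresolvent_sqn]). *)
Definition iresolvent S s f : V :=
  xget 0 [set x | dom S x /\ S x + s%:C *: ('i *: x) = f].

Lemma iresolventP S s f : selfadjoint S -> s ^+ 2 = 1 ->
  dom S (iresolvent S s f) /\
  S (iresolvent S s f) + s%:C *: ('i *: iresolvent S s f) = f.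
Proof.
move=> saS s1; have [x Sx xf] := ishift_surj saS s1 f.
by apply: (@xgetPex _ 0 [set x | dom S x /\ S x + s%:C *: ('i *: x) = f]); exists x.
Qed.

Lemma iresolvent_uniq S s x y : selfadjoint S -> s ^+ 2 = 1 -> dom S x -> dom S y ->
  S x + s%:C *: ('i *: x) = S y + s%:C *: ('i *: y) -> x = y.
Proof.
move=> saS s1 Sx Sy xy; apply/eqP; rewrite -subr_eq0; apply/eqP/sqn_eq0.
have := ishift_sqn saS s1 (domB Sx Sy).
rewrite -[ishift S s _]/(op _ _) (opB (S := ishift S s))//= xy subrr sqn0.
by have := sqn_ge0 (S (x - y)); have := sqn_ge0 (x - y); lra.
Qed.

(** S^2 + I = (S - i) (S + i). *)
Lemma square_resolvent S f : selfadjoint S ->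
  exists u, [/\ dom S u, dom S (S u) & S (S u) + u = f].
Proof.
move=> saS.
have N1 : (-1) ^+ 2 = 1 :> R by rewrite sqrrN expr1n.
have [Sg gf] := @iresolventP S (-1) f saS N1.
have [Su ug] := @iresolventP S 1 (iresolvent S (-1) f) saS (expr1n _ _).
set g := iresolvent S (-1) f in Sg gf Su ug *.
set u := iresolvent S 1 g in Su ug *.
have uE : S u = g - 'i *: u by rewrite -ug scale1r addrK.
have gE : S g = f + 'i *: g by rewrite -gf rmorphN scaleNr scale1r subrK.
exists u; split=> //; first by rewrite uE; apply: domB => //; exact: domZ.
have -> : S (S u) = S g - 'i *: S u.
  by rewrite {1}uE opB ?opZ//; exact: domZ.
by rewrite gE uE scalerBr scale_ii opprK opprD addrA addrK subrK.
Qed.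

Definition graph_dense D S := D `<=` dom S /\
  forall x, dom S x -> forall e, 0 < e ->
    exists y, [/\ D y, sqn (x - y) < e & sqn (S x - S y) < e].

(** Through the isometry (S + i)^-1 graph-norm density becomes density in the
    space. *)
Lemma graph_dense_iresolvent D S : selfadjoint S -> D `<=` dom S ->
  (forall f, approximable [set f | D (iresolvent S 1 f)] f) -> graph_dense D S.
Proof.
move=> saS DS Dres; split=> // x Sx e e0.
have [g Dg xg] := Dres (S x + 1%:C *: ('i *: x)) e e0.
exists (iresolvent S 1 g); have [Sy yg] := iresolventP g saS (expr1n R 2).
have := ishift_sqn saS (expr1n R 2) (domB Sx Sy).
rewrite (opB (S := ishift S 1))//= yg => h; rewrite h opB// in xg.
have := sqn_ge0 (x - iresolvent S 1 g).
have := sqn_ge0 (S x - S (iresolvent S 1 g)).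
by split=> //; lra.
Qed.

(** (S + i)^-1 maps Dom(S), which is dense, into Dom(S^2). *)
Lemma graph_dense_square S : selfadjoint S -> graph_dense (dom (op_comp S S)) S.
Proof.
move=> saS; apply: graph_dense_iresolvent => //; first by move=> x [].
move=> f; apply: approximable_le (sa_dense saS f) => g /= Sg.
have [Su ug] := iresolventP g saS (expr1n R 2); split=> //.
have -> : S (iresolvent S 1 g) = g - 'i *: iresolvent S 1 g.
  by rewrite -{2}ug scale1r addrK.
by apply: domB => //; exact: domZ.
Qed.

Lemma graph_dense_core D S : selfadjoint S -> graph_dense D S -> core D S.
Proof.
move=> saS [DS Dd]; split=> //; apply/seteqP; split=> [[u v] /closure_pairP cl|].
  apply: (sa_closed saS) => e e0; have [[x y] /= [[Dx <-] ux vx]] := cl e e0.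
  by exists x; split; [exact: DS|exact: ltW|exact: ltW].
move=> [u v] [/= Su <-]; apply/closure_pairP => e e0.
by have [y [Dy uy vy]] := Dd u Su e e0; exists (y, S y).
Qed.

(** An estimate of T by the graph norm of S extends from a graph-dense domain
    to all of Dom(S) as T is closed. The constant 4 comes from the crude
    |a + b|^2 <= 2 |a|^2 + 2 |b|^2, used twice. *)
Lemma graph_dense_bound A S T : selfadjoint T -> graph_dense (dom A) S ->
  dom A `<=` dom T ->
  (forall x, dom A x -> sqn (T x) <= sqn (S x) + sqn x) ->
  forall x, dom S x -> dom T x /\ sqn (T x) <= 4 * (sqn (S x) + sqn x).
Proof.
move=> saT [AS dA] AT TS x Sx.
pose F e k := exists y, [/\ dom A y, sqn (x - y) < e / 4,
  sqn (S x - S y) < e / 4 & k = T y].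
have Fex e : 0 < e -> exists k, F e k.
  move=> e0; have e4 : 0 < e / 4 by lra.
  by have [y [Ay xy Sxy]] := dA x Sx _ e4; exists (T y), y.
have [|l lP] := complete_family Fex.
  move=> a b _ _ a0 b0 [y [Ay xy Sxy ->]] [z [Az xz Sxz ->]].
  rewrite -opB; [|exact: AT..].
  apply: le_trans (TS _ (domB Ay Az)) _; rewrite opB; [|exact: AS..].
  have := sqn_tri x y z; rewrite (sqnBC y x).
  have := sqn_tri (S x) (S y) (S z); rewrite (sqnBC (S y) (S x)); lra.
have [Tx Txl] : dom T x /\ T x = l.
  apply: (sa_closed saT) => e e0; have e2 : 0 < e / 2 by lra.
  have [_ [y [Ay xy Sxy _]]] := Fex _ e2; exists y; split; first exact: AT.
    by apply: le_trans (ltW xy) _; lra.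
  have Fy : F (e / 2) (T y) by exists y.
  by rewrite sqnBC; have := lP _ _ e2 Fy => h; lra.
split=> //; apply/ler_addgt0Pr => e e0; have e8 : 0 < e / 8 by lra.
have [_ [y [Ay xy Sxy _]]] := Fex _ e8.
have Fy : F (e / 8) (T y) by exists y.
have := lP _ _ e8 Fy; rewrite -Txl => h1.
have := TS _ Ay; have := sqnD_le (T y) (T x - T y).
have := sqnD_le x (y - x); have := sqnD_le (S x) (S y - S x).
rewrite !(addrC _ (_ - _)) !subrK (sqnBC (T x) (T y)) (sqnBC y x) (sqnBC (S y) (S x)).
lra.
Qed.

Lemma graph_dense_equiv D S T : graph_dense D S -> dom S = dom T ->
  (forall x, dom S x -> sqn (T x) <= 4 * (sqn (S x) + sqn x)) -> graph_dense D T.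
Proof.
move=> [DS dD] ST TS; split=> [x /DS|x]; rewrite -ST// => Sx e e0.
have e8 : 0 < e / 8 by lra.
have [y [Dy xy Sxy]] := dD x Sx _ e8; have Sy := DS _ Dy.
exists y; split=> //; first by lra.
rewrite -opB -?ST//; apply: le_lt_trans (TS _ (domB Sx Sy)) _.
by rewrite opB//; lra.
Qed.

End Resolvent.
(** * Uniqueness of bounded non-negative square roots *)

Section SquareRootUniqueness.
Variables (R : realType) (V : hilbertType R).
Implicit Types (x y z u v w f g : V) (X Y : V -> V).

Definition pos_contraction X := [/\ {morph X : x y / x - y},
  forall x y, rdot (X x) y = rdot x (X y),
  forall x, 0 <= rdot x (X x) &
  forall x, sqn (X x) <= sqn x].

(** That is X^2 <= X: expand <x - X x, X (x - X x)> >= 0. *)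
Lemma pos_contraction_sqn X x : pos_contraction X -> sqn (X x) <= rdot x (X x).
Proof.
move=> [XB Xsym X0 X1]; have := X0 (x - X x).
rewrite XB rdotBl !rdotBr -(Xsym x (X x)) -/(sqn (X x)).
by have := X1 (X x); have := rdot_le (X x) (X (X x)); lra.
Qed.

(** For E = X - Y the hypothesis X^2 = Y^2 reads X E = - E Y, hence
    (I + X) E = E (I - Y). Here I - Y is a contraction, whereas I + X expands:
    |(I + X) d|^2 >= |d|^2 + 3 |X d|^2. *)
Lemma sylvester_bound X Y m : pos_contraction X -> pos_contraction Y ->
  (forall x, X (X x) = Y (Y x)) ->
  (forall x, sqn (X x - Y x) <= m * sqn x) -> 0 <= m ->
  forall x, sqn (X x - Y x) + 3 * sqn (X (X x - Y x)) <= m * sqn x.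
Proof.
move=> pX pY XY mE m0 x; set d := X x - Y x.
have [XB Xsym X0 X1] := pX; have [YB Ysym Y0 Y1] := pY.
have dX : d + X d = X (x - Y x) - Y (x - Y x).
  rewrite /d !XB YB XY.
  by rewrite opprB addrACA [RHS]addrACA [in RHS](addrC (- _)).
have := mE (x - Y x); rewrite -dX sqnD.
have := pos_contraction_sqn d pX.
have : m * sqn (x - Y x) <= m * sqn x.
  rewrite ler_wpM2l// sqnB.
  by have := pos_contraction_sqn x pY; have := Y0 x; lra.
lra.
Qed.

(** Let m be the best constant in |E x|^2 <= m |x|^2, where E = X - Y. The bound
    of [sylvester_bound] for (X, Y) and for (Y, X) adds up to
    |E x|^2 + 3/4 |E^2 x|^2 <= m |x|^2. As E is symmetric,
    |E x|^4 <= |E^2 x|^2 |x|^2, so that m - m^2 / 8 is again such a constant;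
    hence m = 0. *)
Lemma sqrt_unique X Y : pos_contraction X -> pos_contraction Y ->
  (forall x, X (X x) = Y (Y x)) -> X =1 Y.
Proof.
move=> pX pY XY.
have [XB Xsym X0 X1] := pX; have [YB Ysym Y0 Y1] := pY.
pose E x := X x - Y x.
pose K : set R := [set m | 0 <= m /\ forall x, sqn (E x) <= m * sqn x].
have K4 : K 4.
  split=> // x; apply: le_trans (sqnB_le _ _) _.
  by have := X1 x; have := Y1 x; lra.
have infK : has_inf K by split; [exists 4|exists 0 => m []].
pose m := inf K.
have m_ge0 : 0 <= m by apply: lb_le_inf; [exists 4|move=> k []].
have m_le4 : m <= 4 by apply: ge_inf => //; case: infK.
have mE x : sqn (E x) <= m * sqn x.
  apply/ler_addgt0Pr => e e0.
  have s1 : 0 < sqn x + 1 by have := sqn_ge0 x; lra.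
  have [k [k0 kE] km] := inf_adherent (divr_gt0 e0 s1) infK.
  apply: le_trans (kE x) _.
  have : e / (sqn x + 1) * (sqn x + 1) = e by rewrite divfK// lt0r_neq0.
  have := ler_wpM2r (sqn_ge0 x) (ltW km); rewrite -/m.
  by have := divr_gt0 e0 s1; set c := e / _ => ? ? ?; nra.
have improve x : sqn (E x) + 3 / 4 * sqn (E (E x)) <= m * sqn x.
  have h1 := sylvester_bound pX pY XY mE m_ge0 x.
  have mE' z : sqn (Y z - X z) <= m * sqn z by rewrite sqnBC; exact: mE.
  have h2 := sylvester_bound pY pX (fun z => esym (XY z)) mE' m_ge0 x.
  have h3 := sqnB_le (X (E x)) (Y (E x)).
  have eq_Y : sqn (Y (Y x - X x)) = sqn (Y (E x)).
    by rewrite YB /E YB sqnBC.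
  rewrite eq_Y (sqnBC (Y x)) in h2.
  rewrite -/(E x) in h1 h2; rewrite -/(E (E x)) in h3; lra.
have m0 : m = 0.
  apply/eqP; rewrite eq_le m_ge0 andbT leNgt; apply/negP => m_gt0.
  have : m <= m - m ^+ 2 / 8.
    apply: ge_inf; first by case: infK.
    split; first by rewrite expr2; nra.
    move=> x; have := improve x.
    have : sqn (E x) ^+ 2 <= sqn (E (E x)) * sqn x.
      apply: le_trans (cauchy_schwarz _ _).
      by rewrite /E rdotBl Xsym Ysym -rdotBr.
    have := sqn_ge0 (E x); have := sqn_ge0 (E (E x)); have := sqn_ge0 x.
    set s := sqn x; set a := sqn (E x); set b := sqn (E (E x)) => s0 b0 a0 ab h.
    rewrite leNgt; apply/negP => ha.
    have s_gt0 : 0 < s by rewrite lt_neqAle s0 andbT; apply/eqP => s_eq0; nra.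
    have a_ge : m * s / 2 <= a by nra.
    have a2_ge : m ^+ 2 * s ^+ 2 / 4 <= a ^+ 2 by rewrite !expr2 in ha *; nra.
    have as_gt : (m - m ^+ 2 / 8) * s * s < a * s by rewrite ltr_pM2r.
    have hs : (a + 3 / 4 * b) * s <= m * s * s by rewrite ler_pM2r.
    have ms2 : 0 < m ^+ 2 * s ^+ 2 by rewrite mulr_gt0// exprn_gt0.
    have e1 : (m - m ^+ 2 / 8) * s * s = m * s * s - m ^+ 2 * s ^+ 2 / 8 by ring.
    have e2 : (a + 3 / 4 * b) * s = a * s + 3 / 4 * (b * s) by ring.
    lra.
  by have := exprn_gt0 2 m_gt0; lra.
move=> x; apply/eqP; rewrite -subr_eq0; apply/eqP/sqn_eq0/eqP.
rewrite eq_le sqn_ge0 andbT.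
by have := mE x; rewrite m0 mul0r.
Qed.

End SquareRootUniqueness.

(** * Commutation with the square root *)

Section CommuteSquareRoot.
Variables (R : realType) (V : hilbertType R) (S : operator V) (J : {linear V -> V}).
Hypotheses (saS : selfadjoint S) (S_ge0 : forall x, dom S x -> 0 <= rdot x (S x)).
Hypotheses (Jsym : forall x y, rdot (J x) y = rdot x (J y)) (JJ : involutive J).
Hypothesis (JSS : forall x, dom (op_comp S S) x ->
  dom (op_comp S S) (J x) /\ J (S (S x)) = S (S (J x))).
Implicit Types (x y z u v w f g : V).

Let is_sqres f u := [/\ dom S u, dom S (S u) & S (S u) + u = f].

Lemma sqn_J x : sqn (J x) = sqn x.
Proof. by rewrite /sqn Jsym JJ. Qed.

Let sqres_B f g u v : is_sqres f u -> is_sqres g v -> is_sqres (f - g) (u - v).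
Proof.
move=> [Su SSu <-] [Sv SSv <-]; split; rewrite ?opB//; try exact: domB.
by rewrite opprD addrACA.
Qed.

Let sqres_uniq f u v : is_sqres f u -> is_sqres f v -> u = v.
Proof.
move=> uf vf; have := sqres_B uf vf; rewrite subrr.
set w := u - v => -[Sw SSw w0]; apply/eqP; rewrite -subr_eq0; apply/eqP/sqn_eq0.
rewrite -/w; have : rdot (S (S w) + w) w = 0 by rewrite w0 rdot0l.
rewrite rdotDl (sa_sym saS SSw Sw) -[rdot (S w) _]/(sqn (S w)) -[rdot w w]/(sqn w).
by have := sqn_ge0 (S w); have := sqn_ge0 w; lra.
Qed.

(** The bounded operator X = S (S^2 + I)^-1 is a non-negative contraction with
    X^2 = Y - Y^2 for Y = (S^2 + I)^-1. Since J commutes with S^2, it commutes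
    with Y, so that X and J X J have the same square and are equal. This means
    that J commutes with S on Dom(S^2), which is graph-dense in Dom(S). *)
Lemma commute_sqrt x : dom S x -> dom S (J x) /\ S (J x) = J (S x).
Proof.
have [y yP] : {y : V -> V & forall f, is_sqres f (y f)}.
  apply: (@choice _ _ is_sqres) => f; exact: square_resolvent.
have yE f u : is_sqres f u -> y f = u by exact: sqres_uniq.
pose X f := S (y f).
have pX : pos_contraction X.
  split.
  - move=> f g; rewrite /X (yE _ _ (sqres_B (yP f) (yP g))).
    by case: (yP f) => ? _ _; case: (yP g) => ? _ _; rewrite opB.
  - move=> f g; rewrite /X.
    have [Su SSu fE] := yP f; have [Sv SSv gE] := yP g.
    rewrite -[X in rdot _ X = _]gE -[X in _ = rdot X _]fE.
    by rewrite rdotDr rdotDl (sa_sym saS Su Sv) (sa_sym saS SSu SSv).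
  - move=> f; rewrite /X; have [Su SSu fE] := yP f.
    rewrite -[X in rdot X _]fE.
    rewrite rdotDl addr_ge0 ?S_ge0//.
    by rewrite rdotC S_ge0.
  - move=> f; rewrite /X; have [Su SSu fE] := yP f.
    rewrite -[X in _ <= sqn X]fE.
    rewrite sqnD (sa_sym saS SSu Su) -/(sqn (S _)).
    have := sqn_ge0 (S (y f)); have := sqn_ge0 (y f).
    by have := sqn_ge0 (S (S (y f))); lra.
have [XB Xsym X0 X1] := pX.
have XX f : X (X f) = y f - y (y f).
  have [Sv SSv vE] := yP (y f); have [Su _ _] := yP f.
  have SSvE : S (S (y (y f))) = y f - y (y f) by rewrite -{2}vE addrK.
  rewrite /X (yE _ (S (y (y f))))//; split=> //.
    by rewrite SSvE; exact: domB.
  by rewrite SSvE opB// subrK.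
have yJ f : y (J f) = J (y f).
  apply: yE; have [Su SSu uE] := yP f.
  have [[SJu SSJu] JSSu] := JSS (conj Su SSu).
  by split=> //; rewrite -JSSu -linearD uE.
have pY : pos_contraction (fun f => J (X (J f))).
  split.
  - by move=> f g; rewrite !linearB XB linearB.
  - by move=> f g; rewrite Jsym Xsym Jsym.
  - by move=> f; rewrite -Jsym.
  - by move=> f; rewrite sqn_J -(sqn_J f).
have XJ := sqrt_unique pX pY _.
have {}XJ f : X (J f) = J (X f).
  rewrite XJ ?JJ// => g.
  by rewrite JJ !XX !yJ linearB !JJ.
have SJ u : dom (op_comp S S) u -> dom S (J u) /\ S (J u) = J (S u).
  move=> [Su SSu]; have yu : y (S (S u) + u) = u by apply: yE.
  have [[SJu _] _] := JSS (conj Su SSu); split=> //.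
  by have := XJ (S (S u) + u); rewrite /X yJ yu.
move=> Sx; apply: (sa_closed saS) => e e0.
have [_ /(_ x Sx e e0) [z [SSz xz Sxz]]] := graph_dense_square saS.
have [SJz JSz] := SJ z SSz; exists (J z); split=> //.
  by rewrite -linearB sqn_J ltW.
by rewrite JSz -linearB sqn_J ltW.
Qed.

End CommuteSquareRoot.
(** * The Lax-Milgram lemma *)

Section LaxMilgram.
Variables (R : realType) (V : hilbertType R).
Implicit Types (x y z u v w f g : V) (C : operator V).

(** Coercivity gives the lower bound, and it excludes non-zero vectors
    orthogonal to the range. *)
Lemma lax_milgram C K a : dom C = setT -> 0 < a ->
  (forall f, sqn (C f) <= K * sqn f) ->
  (forall f, a * sqn f <= rdot f (C f)) ->
  (forall f, a ^+ 2 * sqn f <= sqn (C f)) /\ forall g, exists f, C f = g.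
Proof.
move=> CT a0 CK Ca.
have C_ge f : a ^+ 2 * sqn f <= sqn (C f).
  have := rdot_le (a%:C *: f) (C f); rewrite sqnZ rdotZl.
  have e2 : a ^+ 2 * sqn f = a * (a * sqn f) by rewrite mulrA.
  by have := ler_wpM2l (ltW a0) (Ca f); lra.
have domC f : dom C f by rewrite CT.
split=> // g; have [||f Cf|w wC|f _ <-] := @closed_surj _ _ C (a ^+ 2) _ _ _ _ g.
- move=> u v uv; split=> //; apply/esym/eqP; rewrite -subr_eq0.
  apply/eqP/sqn_small => e e0.
  have c0 : 0 < 2 + 2 * `|K| by have := normr_ge0 K; lra.
  have [x [_ ux vx]] := uv _ (divr_gt0 e0 c0).
  have ec : e / (2 + 2 * `|K|) * (2 + 2 * `|K|) = e by rewrite divfK// lt0r_neq0.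
  apply: le_trans (sqn_tri (C x) v (C u)) _.
  have := CK (x - u); rewrite opB// (sqnBC x u).
  have := ler_wpM2r (sqn_ge0 (u - x)) (ler_norm K).
  have := ler_wpM2l (normr_ge0 K) ux.
  by move: vx ec; set d := e / _; lra.
- exact: exprn_gt0.
- exact: C_ge.
- apply: sqn_eq0; have := Ca w; rewrite wC//.
  by have := sqn_ge0 w => ? ?; nra.
by exists f.
Qed.

End LaxMilgram.

(** * The operator of the indefinite form *)

Section FormOperator.
Variables (R : realType) (V : hilbertType R) (S : operator V).
Variables (H J : {linear V -> V}).
Variables (alpha K : R).
Hypotheses (saS : selfadjoint S).
Hypotheses (Jsym : forall x y, rdot (J x) y = rdot x (J y)) (JJ : involutive J).
Hypothesis (JS : forall x, dom S x -> dom S (J x) /\ S (J x) = J (S x)).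
Hypotheses (Hsym : forall x y, rdot (H x) y = rdot x (H y)).
Hypotheses (HK : forall x, sqn (H x) <= K * sqn x).
Hypotheses (alpha_gt0 : 0 < alpha) (alpha_le1 : alpha <= 1).
Hypothesis (JH : forall u, alpha * sqn u <= rdot (J u) (H u)).
Implicit Types (x y z u v w f g : V).

Local Notation rp := (iresolvent S 1).
Local Notation rm := (iresolvent S (-1)).

Let p1 : 1 ^+ 2 = 1 :> R. Proof. exact: expr1n. Qed.
Let m1 : (-1) ^+ 2 = 1 :> R. Proof. by rewrite sqrrN expr1n. Qed.

Lemma iresolvent_linear s (a : R[i]) f g : s ^+ 2 = 1 ->
  iresolvent S s (a *: f + g) = a *: iresolvent S s f + iresolvent S s g.
Proof.
move=> s1; have [Su uf] := iresolventP f saS s1.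
have [Sv vg] := iresolventP g saS s1.
have [Sw wE] := iresolventP (a *: f + g) saS s1.
apply: (iresolvent_uniq saS s1) => //; first exact: domP.
rewrite wE -{1}uf -{1}vg.
exact/esym/(opP (o := ishift S s)).
Qed.

Lemma iresolvent_adj f g : rdot (rp f) g = rdot f (rm g).
Proof.
have [Sa af] := iresolventP f saS p1; have [Sb bg] := iresolventP g saS m1.
rewrite -[in LHS]bg -[in RHS]af.
by rewrite rdotDl rdotDr !rdotZl !rdotZr (sa_sym saS Sa Sb) rdot_il; ring.
Qed.

Lemma op_iresolvent_adj f g : rdot (S (rp f)) g = rdot f (S (rm g)).
Proof.
have [Sa af] := iresolventP f saS p1; have [Sb bg] := iresolventP g saS m1.
rewrite -[X in rdot _ X = _]bg -[X in _ = rdot X _]af.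
rewrite rdotDl rdotDr !rdotZl !rdotZr -(sa_sym saS (domZ 'i Sa) Sb) opZ// rdot_il.
by ring.
Qed.

Lemma iresolvent_sqn s f : s ^+ 2 = 1 ->
  sqn (S (iresolvent S s f)) + sqn (iresolvent S s f) = sqn f.
Proof.
move=> s1; have [Sa af] := iresolventP f saS s1.
by rewrite -(ishift_sqn saS s1 Sa) /= af.
Qed.

(* The form <S x, J H S y> + <x, y> transported by (S + i)^-1: see [CE]. *)
Let Cfun f := S (rm (J (H (S (rp f))))) + rm (rp f).

Let dom_iresolvent s f : s ^+ 2 = 1 -> dom S (iresolvent S s f).
Proof. by move=> s1; case: (iresolventP f saS s1). Qed.

Let Cfun_lin (a : R[i]) f g : Cfun (a *: f + g) = a *: Cfun f + Cfun g.
Proof.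
rewrite /Cfun !iresolvent_linear//.
rewrite (opP a (dom_iresolvent f p1) (dom_iresolvent g p1)).
rewrite !linearP !iresolvent_linear//.
rewrite (opP a (dom_iresolvent _ m1) (dom_iresolvent _ m1)).
by rewrite scalerDr addrACA.
Qed.

Let C : operator V :=
  @Operator R V setT Cfun I (fun a x y _ _ => I) (fun a x y _ _ => Cfun_lin a x y).

Let CE f g : rdot g (C f) =
  rdot (S (rp g)) (J (H (S (rp f)))) + rdot (rp g) (rp f).
Proof. by rewrite /= rdotDr -op_iresolvent_adj -iresolvent_adj. Qed.

Let C_bij : (forall f, alpha ^+ 2 * sqn f <= sqn (C f)) /\
  forall g, exists f, C f = g.
Proof.
apply: (@lax_milgram _ _ C (2 * `|K| + 2)) => // f.
  rewrite /= /Cfun; apply: le_trans (sqnD_le _ _) _.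
  have := iresolvent_sqn f p1; have := iresolvent_sqn (rp f) m1.
  have := iresolvent_sqn (J (H (S (rp f)))) m1; rewrite (sqn_J Jsym JJ).
  have := HK (S (rp f)).
  have : K * sqn (S (rp f)) <= `|K| * sqn f.
    apply: le_trans (ler_wpM2r (sqn_ge0 _) (ler_norm K)) _.
    by rewrite ler_wpM2l// -(iresolvent_sqn f p1) lerDl sqn_ge0.
  have := sqn_ge0 (S (rp f)); have := sqn_ge0 (rp f).
  have := sqn_ge0 (rm (J (H (S (rp f))))); have := sqn_ge0 (S (rm (rp f))).
  by have := sqn_ge0 (rm (rp f)); lra.
rewrite CE -Jsym -/(sqn _) -(iresolvent_sqn f p1) mulrDr lerD//.
by rewrite ler_piMl ?sqn_ge0.
Qed.

Definition form_op : operator V := op_comp S (op_comp (everywhere H) S).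

Lemma form_op_dom : dom form_op = [set x | dom S x /\ dom S (H (S x))].
Proof. by apply/seteqP; split=> x /= [] // [? _]. Qed.

(* [C f = rm z] says that the form at (x, rp f) is <x, z> for all x. *)
Let form_op_solve f z : C f = rm z ->
  dom form_op (rp f) /\ form_op (rp f) + J (rp f) = J z.
Proof.
move=> Cf; have Sy := dom_iresolvent f p1; set y := rp f in Sy *.
have [SJHy SJHyE] : dom S (J (H (S y))) /\ S (J (H (S y))) = z - y.
  apply: (sa_mem saS) => x Sx.
  pose g := S x + 1%:C *: ('i *: x).
  have gx : rp g = x.
    by have [Sg gE] := iresolventP g saS p1; exact: (iresolvent_uniq saS p1).
  have := CE f g; rewrite Cf -iresolvent_adj gx rdotBr => ->.
  by rewrite addrK.
have [SHy SHyE] := JS SJHy; rewrite JJ in SHy SHyE.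
rewrite form_op_dom; split=> //=.
by rewrite SHyE SJHyE linearB subrK.
Qed.

Lemma form_op_J_surj z : exists2 y, dom form_op y & form_op y + J y = z.
Proof.
have [f Cf] := proj2 C_bij (rm (J z)).
have [By yE] := form_op_solve Cf; exists (rp f) => //.
by rewrite yE JJ.
Qed.

(** Dom(B) is the image under (S + i)^-1 of C^-1 (Dom(S)), and C^-1 is bounded
    and onto. *)
Lemma form_op_graph_dense : graph_dense (dom form_op) S.
Proof.
apply: graph_dense_iresolvent => // [x [[]]//|f e e0].
have a2 : 0 < alpha ^+ 2 by rewrite exprn_gt0.
have [g Sg fg] := sa_dense saS (C f) (mulr_gt0 a2 e0).
have [h Ch] := proj2 C_bij g; exists h.
  pose z := S g + (-1)%:C *: ('i *: g).
  have [Sz zE] := iresolventP z saS m1.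
  apply: (proj1 (@form_op_solve h z _)).
  by rewrite Ch; apply: (iresolvent_uniq saS m1).
rewrite -(ltr_pM2l a2); apply: le_lt_trans (proj1 C_bij _) _.
by rewrite opB// Ch.
Qed.

Lemma form_op_sym x y : dom form_op x -> dom form_op y ->
  rdot (form_op x) y = rdot x (form_op y).
Proof.
move=> [[Sx _] SHx] [[Sy _] SHy] /=.
by rewrite (sa_sym saS SHx Sy) Hsym (sa_sym saS Sx SHy).
Qed.

(** Let (u, v) be in the adjoint graph of B, and solve B y + J y = v + J u. Then
    u - y is orthogonal to the range of B + J, hence u = y. *)
Lemma form_op_selfadjoint : selfadjoint form_op.
Proof.
apply: sa_intro => [x e e0||u v uv].
- have e4 : 0 < e / 4 by lra.
  have [y Sy xy] := sa_dense saS x e4.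
  have [_ /(_ y Sy _ e4) [z [Bz yz _]]] := form_op_graph_dense.
  by exists z => //; have := sqn_tri y x z; lra.
- exact: form_op_sym.
have [y By yE] := form_op_J_surj (v + J u).
suff -> : u = y by [].
apply/eqP; rewrite -subr_eq0; apply/eqP/sqn_eq0.
have [x Bx xE] := form_op_J_surj (u - y).
rewrite /sqn -{1}xE rdotDl !rdotBr (uv x Bx) (form_op_sym Bx By) !Jsym.
have : rdot x (form_op y + J y) = rdot x (v + J u) by rewrite yE.
by rewrite !rdotDr; lra.
Qed.

End FormOperator.

(** * Coercivity from the diagonal blocks *)

Section Coercivity.
Variables (R : realType) (V : hilbertType R) (H J : {linear V -> V}).
Implicit Types (x y u : V).

Lemma bounded_sqn : bounded_op H -> exists K : R, forall x, sqn (H x) <= K * sqn x.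
Proof.
move=> [M HM]; exists (M ^+ 2) => x.
rewrite -lecR rmorphM rmorphXn/= -!sqn_norm -exprMn lerXn2r// nnegrE//.
by apply: le_trans (HM x).
Qed.

(** With p, q the components of u one has J u = p - q, and p is orthogonal to q
    as |p - q| = |J u| = |u| = |p + q|; the mixed terms of
    Re <p - q, H (p + q)> cancel by the symmetry of H. *)
Lemma coercive_of_blocks (alpha : R) :
  (forall x y, rdot (J x) y = rdot x (J y)) -> involutive J ->
  (forall x y, rdot (H x) y = rdot x (H y)) ->
  (forall x : V, let u := proj_of J x in
     alpha%:C * `|u| ^+ 2 <= hdot u (H u)) ->
  (forall x : V, let u := coproj_of J x in
     hdot u (H u) <= - alpha%:C * `|u| ^+ 2) ->
  forall u, alpha * sqn u <= rdot (J u) (H u).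
Proof.
move=> Jsym JJ Hsym PHP QHQ u.
have := PHP u; have := QHQ u; rewrite /=.
set p := proj_of J u; set q := coproj_of J u.
rewrite !sqn_norm !hdotRe -rmorphN -!rmorphM !lecE /= => /andP[_ hq] /andP[_ hp].
have uE : u = p + q by rewrite /q /coproj_of -/p addrC subrK.
have JuE : J u = p - q.
  have pp : p + p = u + J u.
    by rewrite /p /proj_of -scalerDl -[2^-1]div1r -splitr scale1r.
  by rewrite /q /coproj_of -/p opprB addrA pp addrAC subrr add0r.
have pq : rdot p q = 0.
  by have := sqn_J Jsym JJ u; rewrite JuE {1}uE sqnB sqnD; lra.
have HuE : H u = H p + H q by rewrite -linearD -uE.
rewrite HuE JuE uE sqnD pq rdotBl !rdotDr.
by have := Hsym p q; rewrite rdotC; lra.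
Qed.

End Coercivity.
(** * The representation theorem *)

Theorem theorem2p3 (R : realType) (V : hilbertType R)
    (A : operator V) (H J : {linear V -> V}) (alpha : R)
    (sqrtA : operator V)
    (A_sa : selfadjoint A) (A_ge0 : nonnegative A)
    (sqrtAP : is_sqrt A sqrtA)
    (H_sa : selfadjoint (everywhere H)) (H_bnd : bounded_op H)
    (H_inv : boundedly_invertible H)
    (J_inv : selfadjoint_involution J)
    (J_neq1 : J <> idfun :> (V -> V)) (J_neqN1 : J <> -%R :> (V -> V))
    (J_comm : commutes_with J A)
    (alpha_gt0 : 0 < alpha) (alpha_le1 : alpha <= 1)
    (PHP : forall x : V, let u := proj_of J x in
       alpha%:C * `|u| ^+ 2 <= hdot u (H u))
    (QHQ : forall x : V, let u := coproj_of J x in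
       hdot u (H u) <= - alpha%:C * `|u| ^+ 2) :
  exists B : operator V,
    [/\ selfadjoint B /\ represents (dom sqrtA) (sform sqrtA H) B,
        forall B' : operator V, selfadjoint B' ->
          represents (dom sqrtA) (sform sqrtA H) B' -> op_eq B' B,
        op_eq B (op_comp sqrtA (op_comp (everywhere H) sqrtA)) /\
        dom B = [set x | dom sqrtA x /\ dom sqrtA (H (sqrtA x))],
        forall T : operator V, is_sqrt (op_add A (op_id V)) T ->
          core (dom B) T
      & core (dom B) sqrtA].
Proof.
have [saS S_ge0 [domSS SSE]] := sqrtAP; have [_ saJ JJ] := J_inv.
set S := sqrtA in saS S_ge0 domSS SSE *.
have Jsym x y : rdot (J x) y = rdot x (J y) by exact: (sa_sym saJ).
have Hsym x y : rdot (H x) y = rdot x (H y) by exact: (sa_sym H_sa).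
have [K HK] := bounded_sqn H_bnd.
have JH := coercive_of_blocks Jsym JJ Hsym PHP QHQ.
have JS x : dom S x -> dom S (J x) /\ S (J x) = J (S x).
  apply: (commute_sqrt saS _ Jsym JJ) => [y Sy|y SSy].
    by have := S_ge0 y Sy; rewrite hdotRe lecE => /andP[].
  have [AJy JAy] := J_comm y (eq_ind _ (fun D => D y) SSy _ domSS).
  rewrite domSS; split=> //.
  rewrite -[S (S y)]/(op_comp S S y) -[S (S (J y))]/(op_comp S S (J y)).
  by rewrite !SSE ?domSS// -domSS.
have saB := form_op_selfadjoint saS Jsym JJ JS Hsym HK alpha_gt0 alpha_le1 JH.
have dB := form_op_graph_dense saS Jsym JJ JS HK alpha_gt0 alpha_le1 JH.
have domB' := form_op_dom S H.
exists (form_op S H); split=> //.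
- split=> //; split=> [x [[]]//|x y Sx [_ SHSy]].
  have : graph S (H (S y), S (H (S y))) by [].
  by rewrite -(proj2 saS); apply.
- move=> B' saB' [B'S B'E].
  have B'B y : dom B' y -> dom S (H (S y)) /\ S (H (S y)) = B' y.
    move=> B'y; apply: (sa_mem saS) => x Sx.
    by have := B'E x y Sx B'y; rewrite /sform /rdot => ->.
  split=> [|y /B'B[_ <-]//]; apply/seteqP; split=> y.
    by move=> B'y; have [] := B'B y B'y; rewrite domB'; split=> //; exact: B'S.
  move=> By; apply: (proj1 (sa_mem (v := form_op S H y) saB' _)) => x B'x.
  have [SHx <-] := B'B x B'x.
  rewrite -(form_op_sym saS Hsym _ By)// domB'; split=> //; exact: B'S.
- move=> T [saT _ [domTT TTE]].
  have dA : dom (op_comp S S) = dom (op_comp T T).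
    by rewrite domSS domTT; apply/seteqP; split=> x // [].
  have SST x : dom (op_comp S S) x -> sqn (T x) = sqn (S x) + sqn x.
    move=> SSx; have : dom (op_comp T T) x by rewrite -dA.
    move=> TTx; have [Sx SSx'] := SSx; have [Tx TTx'] := TTx.
    rewrite /sqn -(sa_sym saT TTx' Tx) -[T (T x)]/(op_comp T T x) TTE//=.
    by rewrite -SSE//= rdotDl (sa_sym saS SSx' Sx).
  have ST := graph_dense_bound saT (graph_dense_square saS) _ _.
  have {}ST x : dom S x -> dom T x /\ sqn (T x) <= 4 * (sqn (S x) + sqn x).
    by apply: ST => [y|y SSy]; [rewrite dA => -[]|rewrite SST].
  have TS x : dom T x -> dom S x /\ sqn (S x) <= 4 * (sqn (T x) + sqn x).
    apply: (graph_dense_bound saS (graph_dense_square saT)) => y.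
      by rewrite -dA; case.
    rewrite -dA.
    by move=> SSy; rewrite SST//; have := sqn_ge0 y; lra.
  apply: (graph_dense_core saT); apply: (graph_dense_equiv dB).
    by apply/seteqP; split=> x; [move=> /ST[]|move=> /TS[]].
  by move=> x /ST[].
- exact: graph_dense_core.
Qed.
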